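(* Let $p\ge 2$ be an integer. Then $p$ is prime if and only if all the entries of the $(p-1)$-th row of Alkarkhi's triangle are zero modulo $p$, that is, if and only if $K(p-1,d)\equiv 0 \pmod p$ for every integer $d$ with $1\le d\le p-1$.
   Context: Alkarkhi's triangle is the infinite array of integers $K(i,j)$, with row index $i\ge 1$ and column index $j\ge 1$, defined by $K(i,j)=\binom{i}{j}+(-1)^{j+1}$ if $i\ge j>0$, and $K(i,j)=0$ if $0<i<j$. *)

(* Defs.v *)
From mathcomp Require Import all_boot all_order all_algebra.
Set Implicit Arguments.
Unset Strict Implicit.
Unset Printing Implicit Defensive.
Import GRing.Theory.
Local Open Scope ring_scope.

(* Alkarkhi's triangle is indexed by i, j >= 1; the value 0 given here to an
   index equal to 0 is a dummy. *)
Definition alkarkhi (i j : nat) : int :=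
  if (0 < j <= i)%N then 'C(i, j)%:Z + (-1) ^+ j.+1 else 0.

(* Main.v *)
Require Import Defs.
From mathcomp Require Import all_boot all_order all_algebra.
From mathcomp Require Import ring.

(** The entries of row [p - 1] are the deviations of the binomials
    [C(p - 1, d)] from the alternating signs [(-1) ^ d]. By Pascal's rule the
    sum of two consecutive deviations is [C(p, d + 1)], where the signs cancel,
    and the deviation at [d = 0] vanishes.

    If [p] is prime it divides [C(p, d)] for [0 < d < p], so that divisibility
    propagates along the row from [d = 0].

    Conversely, suppose that [p] divides the whole row and let [q = k + 1] be a
    divisor of [p] with [1 < q < p]. Then [p] divides [C(p, q)], a sum of two
    deviations. The absorption identity [p * C(p - 1, k) = q * C(p, q)], divided
    by [p], shows that [q] divides [C(p - 1, k)]. But [q] divides [p], hence the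
    deviation at [k], so [C(p - 1, k)] is congruent to a sign modulo [q] and [q]
    divides 1. *)

Import GRing.Theory.
Local Open Scope ring_scope.

Definition bin_dev (n d : nat) : int := 'C(n, d)%:Z - (-1) ^+ d.

Lemma bin_dev0 n : bin_dev n 0 = 0.
Proof. by rewrite /bin_dev bin0 expr0 subrr. Qed.

Lemma alkarkhi_bin_dev n d : (0 < d <= n)%N -> alkarkhi n d = bin_dev n d.
Proof. by move=> dn; rewrite /alkarkhi /bin_dev dn exprS mulN1r. Qed.

(** Pascal's rule: consecutive signs are opposite, so they cancel in the sum. *)
Lemma bin_dev_pascal n d : bin_dev n d.+1 + bin_dev n d = 'C(n.+1, d.+1)%:Z.
Proof. by rewrite /bin_dev binS PoszD exprS; ring. Qed.

Lemma prime_dvd_bin_dev n d :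
  prime n.+1 -> (d <= n)%N -> (n.+1%:Z %| bin_dev n d)%Z.
Proof.
move=> n1_pr; elim: d => [|d IHd] dn; first by rewrite bin_dev0 dvdz0.
rewrite -[bin_dev n d.+1](addrK (bin_dev n d)) bin_dev_pascal.
by rewrite rpredB ?IHd ?(ltnW dn) // dvdzE prime_dvd_bin.
Qed.

(** A proper divisor [q > 1] of [n.+1] cannot exist: absorption would make it
    divide [C(n, q - 1)], which is congruent to a sign modulo [q]. *)
Lemma dvd_bin_dev_prime n :
    (0 < n)%N -> (forall d, (d <= n)%N -> (n.+1%:Z %| bin_dev n d)%Z) ->
  prime n.+1.
Proof.
move=> n_gt0 dvd_dev; apply/primeP; split=> // -[|k] q_n1.
  by rewrite dvd0n in q_n1.
have [-> // | k_gt0] := posnP k.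
have [k_lt_n | n_le_k] := ltnP k n; last first.
  by rewrite orbC eqn_leq (dvdn_leq _ q_n1) // ltnS n_le_k.
have n1_bin : (n.+1 %| 'C(n.+1, k.+1))%N.
  have := rpredD (dvd_dev _ k_lt_n) (dvd_dev _ (ltnW k_lt_n)).
  by rewrite bin_dev_pascal dvdzE.
have q_bin : (k.+1 %| 'C(n, k))%N.
  rewrite -(@dvdn_pmul2l n.+1) // mul_bin_diag mulnC.
  exact: dvdn_mul.
have q_dev : (k.+1%:Z %| bin_dev n k)%Z.
  by apply: dvdz_trans (dvd_dev _ (ltnW k_lt_n)); rewrite dvdzE.
have : (k.+1%:Z %| (-1) ^+ k)%Z.
  have -> : (-1) ^+ k = 'C(n, k)%:Z - bin_dev n k by rewrite /bin_dev; ring.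
  by apply: rpredB => //; rewrite dvdzE.
by rewrite dvdzE abszX exp1n dvdn1 => ->.
Qed.

Local Close Scope ring_scope.

Theorem theorem1 (p : nat) (hp : 2 <= p) :
  prime p <->
  (forall d : nat, 1 <= d <= p - 1 -> (alkarkhi (p - 1) d = 0 %[mod p])%Z).
Proof.
case: p hp => [//|n] n_gt0; rewrite subn1 /=; split=> [n1_pr d d_n | row0].
  apply/eqP; rewrite eqz_mod_dvd subr0 alkarkhi_bin_dev //.
  by apply: prime_dvd_bin_dev => //; case/andP: d_n.
apply: dvd_bin_dev_prime => // -[_ | d d_n]; first by rewrite bin_dev0 dvdz0.
rewrite -alkarkhi_bin_dev // -[alkarkhi _ _]subr0 -eqz_mod_dvd.
by apply/eqP/row0.
Qed.
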